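(* Let $G$ be a completely metrizable topological group with identity $e$, let $d$ be a left-invariant compatible metric on $G$, let $\rho$ be a left-invariant continuous pseudometric on $G$, and let $T\colon G\to G$ be a continuous endomorphism of $G$. Then the following assertions are equivalent: (1) $T$ admits a dense set of distributionally irregular points of type $1$; (2) $T$ admits a residual set of distributionally irregular points of type $1$; (3) for every sequence $(O_j)_{j\in\mathbb{N}}$ of nonempty open subsets of $G$, there exists a sequence $(K_j)_{j\in\mathbb{N}}$ of Cantor sets with $K_j\subset O_j$ such that $\bigcup_{j=1}^\infty K_j$ is distributionally extremely scrambled of type $1$; (4) the distributionally proximal cell of $e$ is dense in $G$ and $T$ admits a dense set of distributionally unbounded points.
   Context: A topological group is completely metrizable if its topology is induced by some complete metric. A compatible metric $d$ on $G$ is a metric inducing the topology of $G$ (not required to be complete). A (pseudo)metric $d$ is left-invariant if $d(zx,zy)=d(x,y)$ for all $x,y,z\in G$. A continuous endomorphism is a continuous group homomorphism $G\to G$. $\mathbb{N}$ is the set of positive integers. For $A\subset\mathbb{N}$, $\overline{\mathrm{dens}}(A)=\limsup_{n\to\infty}\frac{\mathrm{card}(A\cap[1,n])}{n}$. A set is residual if it contains a dense $G_\delta$ subset. A Cantor set is a subset homeomorphic to the Cantor ternary set. All ''extreme'', ''irregular'' and ''unbounded'' notions are with respect to the fixed $\rho$: A point $x\in G$ is distributionally unbounded if there exists $B\subset\mathbb{N}$ with $\overline{\mathrm{dens}}(B)=1$ such that $\lim_{B\ni n\to\infty}\rho(T^nx,e)=\infty$. A point $x\in G$ is distributionally irregular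 of type $1$ for $T$ if it is distributionally unbounded and there exists $A\subset\mathbb{N}$ with $\overline{\mathrm{dens}}(A)=1$ such that $\lim_{A\ni n\to\infty}T^nx=e$. A pair $(x,y)\in G\times G$ is distributionally proximal if for every $\varepsilon>0$, $\overline{\mathrm{dens}}(\{n\in\mathbb{N}:d(T^nx,T^ny)<\varepsilon\})=1$; the distributionally proximal cell of $e$ is the set of $y\in G$ such that $(e,y)$ is distributionally proximal. A pair $(x,y)$ is distributionally extremely chaotic of type $1$ if it is distributionally proximal and for any $M>0$, $\overline{\mathrm{dens}}(\{n\in\mathbb{N}:\rho(T^nx,T^ny)>M\})=1$. A set $K\subset G$ is distributionally extremely scrambled of type $1$ if any two distinct points of $K$ form such a pair. *)

(* Defs.v *)
From HB Require Import structures.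
From mathcomp Require Import all_boot all_order all_algebra.
From mathcomp Require Import all_classical all_reals all_analysis borel_hierarchy.

Set Implicit Arguments.
Unset Strict Implicit.
Unset Printing Implicit Defensive.

Import Order.TTheory GRing.Theory Num.Theory.
Import numFieldNormedType.Exports.

Local Open Scope classical_set_scope.
Local Open Scope ring_scope.

(* The carrier may be infinite and the group is not assumed abelian; no
   separation axiom is imposed. *)
HB.mixin Record isTopologicalGroup G of Topological G & Group G := {
  mulg_continuous : continuous (fun p : G * G => (p.1 * p.2)%g);
  invg_continuous : continuous (fun x : G => (x^-1)%g)
}.

#[short(type="topologicalGroupType")]
HB.structure Definition TopologicalGroup :=
  {G of isTopologicalGroup G & Topological G & Group G}.

Section Metrics.
Context {R : realType}.

Definition is_pseudometric {X : Type} (d : X -> X -> R) : Prop :=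
  [/\ forall x y, 0 <= d x y, forall x, d x x = 0,
      forall x y, d x y = d y x & forall x y z, d x z <= d x y + d y z].

Definition is_metric {X : Type} (d : X -> X -> R) : Prop :=
  is_pseudometric d /\ forall x y, d x y = 0 -> x = y.

Definition complete_metric {X : Type} (d : X -> X -> R) : Prop :=
  is_metric d /\
  forall u : nat -> X,
    (forall e, 0 < e ->
       exists N, forall m n, (N <= m)%N -> (N <= n)%N -> d (u m) (u n) < e) ->
    exists l, d (u n) l @[n --> \oo] --> (0 : R).

Definition induces_topology {X : topologicalType} (d : X -> X -> R) : Prop :=
  forall (x : X) (A : set X),
    nbhs x A <-> exists2 e, 0 < e & [set y | d x y < e] `<=` A.

Definition compatible_metric {X : topologicalType} (d : X -> X -> R) : Prop :=
  is_metric d /\ induces_topology d.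

Definition completely_metrizable (X : topologicalType) : Prop :=
  exists d : X -> X -> R, complete_metric d /\ induces_topology d.

Definition left_invariant {G : groupType} (d : G -> G -> R) : Prop :=
  forall x y z : G, d (z * x)%g (z * y)%g = d x y.

Definition continuous_pseudometric {X : topologicalType}
    (d : X -> X -> R) : Prop :=
  is_pseudometric d /\ continuous (fun p : X * X => d p.1 p.2).

End Metrics.

Arguments completely_metrizable R X : clear implicits.

(* Sets of positive integers are represented by sets of natural numbers:
   membership of 0 affects neither the density nor limits along the set. The
   term of index 0 below is 0 / 0 = 0 and does not affect the limsup. *)
Definition upper_density (R : realType) (A : set nat) : \bar R :=
  limn_esup (fun n => ((count (mem A) (iota 1 n))%:R / n%:R : R)%:E).

Definition residual {X : topologicalType} (A : set X) : Prop :=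
  exists D : set X, [/\ Gdelta D, dense D & D `<=` A].

(* The reals of the form \sum_(n >= 1) c_n / 3 ^ n with all c_n in {0, 2}. *)
Definition ternary_cantor_set (R : realType) : set R :=
  [set x | exists a : nat -> bool,
    series (fun n => (a n).*2%:R / 3 ^+ n.+1 : R) @ \oo --> x].

(* The subsets A and B are homeomorphic for their subspace topologies. *)
Definition homeomorphic_sets {X Y : topologicalType}
    (A : set X) (B : set Y) : Prop :=
  exists (f : X -> Y) (g : Y -> X),
    [/\ {within A, continuous f}, {within B, continuous g},
        {homo f : x / A x >-> B x} & {homo g : y / B y >-> A y}] /\
    ({in A, cancel f g} /\ {in B, cancel g f}).

Definition is_cantor_set (R : realType) {X : topologicalType} (K : set X) :
    Prop :=
  homeomorphic_sets K (@ternary_cantor_set R).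

Section DistributionalChaos.
Context {R : realType} {G : topologicalGroupType}.
Variables (d rho : G -> G -> R) (T : G -> G).

Definition distributionally_unbounded (x : G) : Prop :=
  exists B : set nat, upper_density R B = 1%E /\
    rho (iter n T x) 1%g @[n --> within B \oo] --> +oo.

Definition distributionally_irregular1 (x : G) : Prop :=
  distributionally_unbounded x /\
  exists A : set nat, upper_density R A = 1%E /\
    iter n T x @[n --> within A \oo] --> (1%g : G).

Definition distributionally_proximal (x y : G) : Prop :=
  forall e : R, 0 < e ->
    upper_density R [set n | d (iter n T x) (iter n T y) < e] = 1%E.

Definition distributionally_proximal_cell (x : G) : set G :=
  [set y | distributionally_proximal x y].

Definition distributionally_extremely_chaotic1 (x y : G) : Prop :=
  distributionally_proximal x y /\
  forall M : R, 0 < M ->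
    upper_density R [set n | M < rho (iter n T x) (iter n T y)] = 1%E.

Definition distributionally_extremely_scrambled1 (K : set G) : Prop :=
  forall x y, K x -> K y -> x <> y -> distributionally_extremely_chaotic1 x y.

End DistributionalChaos.

(* Main.v *)
Require Import Defs.
From HB Require Import structures.
From mathcomp Require Import all_boot all_order all_algebra.
From mathcomp Require Import all_classical all_reals all_analysis.
From mathcomp Require Import zify lra.

Set Implicit Arguments.
Unset Strict Implicit.
Unset Printing Implicit Defensive.

Import Order.TTheory GRing.Theory Num.Theory.
Import numFieldNormedType.Exports.

Local Open Scope classical_set_scope.
Local Open Scope ring_scope.

(** For a fixed [n], consider the points [z] whose orbit, for some [k >= n],
spends more than the fraction [1 - 1/(n+1)] of the times [1, ..., k] within
distance [1/(n+1)] of the identity, and, for some other such [k], more than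
that fraction at [rho]-distance greater than [n] from it.  By continuity of
the iterates these points form an open set [chaotic_level n], and the levels
decrease with [n].  Everything rests on the fact that the intersection of the
levels is the set of distributionally irregular points of type 1: a diagonal
choice of times ([density1_diagonal]) turns the countably many density
conditions into convergence along a single set of upper density 1.  Because
[d] and [rho] are left-invariant and [T] is an endomorphism, the orbits of [x]
and [y] are compared by looking at the orbit of [x^-1 * y] alone; so a pair
[(x, y)] is distributionally extremely chaotic exactly when [x^-1 * y] is
irregular.

Each of the assertions makes every level dense: the level [n] contains the
irregular points, and it is the intersection of two open sets that contain,
respectively, the proximal cell of the identity and the unbounded points.
Dense open levels give (3) by a construction in the manner of Mycielski
([cantor_family]).  For nonempty open sets [C] and [C'] and a dense open [U],
one can shrink [C] and [C'] so that [x^-1 * y] lies in [U] for all [x] in [C]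
and [y] in [C'].  Applying this to all pairs of nodes at each stage of a
simultaneous Cantor scheme of balls of a complete metric, one scheme inside
each [O j], makes [x^-1 * y] belong to all levels for any two distinct points
of the union of the limit sets.  The identity is not in any level, which
forces the balls at different nodes to be disjoint, so that the limit sets are
Cantor sets.

Conversely, (3) makes the irregular points dense: a nonempty open [W]
contains [A^-1 * B] for some nonempty open [A] and [B], and a quotient of two
distinct scrambled points, one in [A] and one in [B], is an irregular point of
[W].  Hence (4) implies (1) through (3), and the Baire property enters only
through the Cantor schemes. *)

(** * Sets of upper density one *)

Definition visits (A : set nat) (k : nat) : nat := count (mem A) (iota 1 k).

Lemma visits_le (A : set nat) k : (visits A k <= k)%N.
Proof. by rewrite -[leqRHS](size_iota 1 k) count_size. Qed.

(** At most [N] visits are lost when [A] is contained in [B] only beyond [N];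
this is how finitely many times, or the times before the last stage of a
diagonal construction, are discarded. *)
Lemma visits_sub_after (A B : set nat) N k :
  (forall i, (N < i <= k)%N -> A i -> B i) ->
  (visits A k <= N + visits B k)%N.
Proof.
elim: k => [|k IH] sAB; first by rewrite /visits.
have E C : visits C k.+1 = (visits C k + (k.+1 \in C))%N.
  by rewrite /visits -(addn1 k) iotaD count_cat /= add1n addn0 addn1.
have [Nk|kN] := ltnP N k.+1; last first.
  by apply: leq_trans (visits_le _ _) _; lia.
rewrite !E addnA leq_add//.
  by apply: IH => i /andP[Ni ik]; apply: sAB; rewrite Ni ltnW.
case: (boolP (k.+1 \in A)) => // /set_mem Ak.
by rewrite (mem_set (sAB _ _ Ak))// Nk leqnn.
Qed.

Lemma visits_sub (A B : set nat) k : A `<=` B -> (visits A k <= visits B k)%N.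
Proof. by move=> sAB; apply: (@visits_sub_after _ _ 0) => i _; exact: sAB. Qed.

(** Since the proportions of visits never exceed 1, their limsup equals 1 as
soon as they come arbitrarily close to 1 arbitrarily late.  Multiplying by [k]
also rules out [k = 0]. *)
Lemma upper_density1P (R : realType) (A : set nat) :
  upper_density R A = 1%E <->
  forall e : R, 0 < e -> forall N, exists2 k, (N <= k)%N &
    (1 - e) * k%:R < (visits A k)%:R.
Proof.
rewrite /upper_density /limn_esup limf_esupE; split.
  move=> A1 e e0 N.
  pose f n : \bar R := ((visits A n)%:R / n%:R : R)%:E.
  have : ((1 - e)%:E < ereal_sup (f @` [set k | (maxn N 1 <= k)%N]))%E.
    apply: (@lt_le_trans _ _ 1%E); first by rewrite lte_fin; lra.
    rewrite -A1; apply: ereal_inf_lbound.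
    by exists [set k | (maxn N 1 <= k)%N] => //; exact: nbhs_infty_ge.
  case/ereal_sup_gt => _ [k /= +] <-; rewrite geq_max => /andP[Nk k0].
  rewrite /f lte_fin ltr_pdivlMr ?ltr0n// => ek.
  by exists k.
move=> H; apply/eqP; rewrite eq_le; apply/andP; split.
  apply: ge_ereal_inf; exists (ereal_sup ((fun n =>
     ((visits A n)%:R / n%:R : R)%:E) @` setT)).
    by exists setT => //; exact: filterT.
  apply: ge_ereal_sup => _ [k _ <-]; rewrite lee_fin.
  case: k => [|k]; first by rewrite invr0 mulr0 ler01.
  by rewrite ler_pdivrMr ?ltr0n// mul1r ler_nat visits_le.
apply: le_ereal_inf_tmp => _ [V [N _ NV] <-].
apply/lee_addgt0Pr => e e0.
have [k Nk ek] := H e e0 (maxn N 1).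
move: Nk; rewrite geq_max => /andP[Nk k0].
apply: (@le_trans _ _ (((visits A k)%:R / k%:R : R)%:E + e%:E)%E).
  rewrite -EFinD lee_fin -lerBlDr ler_pdivlMr ?ltr0n//; exact: ltW.
rewrite leeD2r//; apply: ereal_sup_ubound; exists k => //.
exact: NV.
Qed.

Lemma upper_density1_sub (R : realType) (A B : set nat) : A `<=` B ->
  upper_density R A = 1%E -> upper_density R B = 1%E.
Proof.
move=> sAB /upper_density1P HA; apply/upper_density1P => e e0 N.
have [k Nk Hk] := HA e e0 N; exists k => //.
by apply: lt_le_trans Hk _; rewrite ler_nat visits_sub.
Qed.

Lemma small_inv (R : realType) (e : R) : 0 < e ->
  exists N, forall n, (N <= n)%N -> n.+1%:R^-1 < e.
Proof.
move=> e0; have [N _ H] := near_infty_natSinv_lt (PosNum e0).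
by exists N => n Nn; apply: H.
Qed.

(** The same [n] is the index of the set, the lower bound for the time and the
tolerance, so that the density conditions on all [A m] become a condition
indexed by a single natural number, each instance of which depends on finitely
many times. *)
Definition frequently (R : realType) (A : nat -> set nat) (n : nat) : Prop :=
  exists2 k, (n <= k)%N & (1 - n.+1%:R^-1 : R) * k%:R < (visits (A n) k)%:R.

Section Decreasing.
Variables (R : realType) (A : nat -> set nat).
Hypothesis Adec : forall m n, (m <= n)%N -> A n `<=` A m.

Lemma frequently_dec m n : (m <= n)%N -> frequently R A n -> frequently R A m.
Proof.
move=> mn [k nk H]; exists k; first exact: leq_trans nk.
apply: (@lt_le_trans _ _ (visits (A n) k)%:R); last first.
  by rewrite ler_nat visits_sub//; exact: Adec.
apply: le_lt_trans H; apply: ler_wpM2r => //.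
by rewrite lerB// lef_pV2 ?posrE ?ltr0n// ler_nat.
Qed.

Lemma density1_frequentlyP :
  (forall m, upper_density R (A m) = 1%E) <-> (forall n, frequently R A n).
Proof.
split=> [H n|H m].
  have /upper_density1P/(_ n.+1%:R^-1) := H n.
  by rewrite invr_gt0 ltr0n => /(_ isT n).
apply/upper_density1P => e e0 N.
have [M HM] := small_inv e0.
have mM : (maxn m N <= maxn (maxn m N) M)%N by rewrite leq_maxl.
have [k Mk H1] := H (maxn (maxn m N) M).
have Me := HM _ (leq_maxr (maxn m N) M).
exists k; first by lia.
apply: (@lt_le_trans _ _ (visits (A (maxn (maxn m N) M)) k)%:R); last first.
  by rewrite ler_nat visits_sub//; apply: Adec; lia.
apply: le_lt_trans H1; apply: ler_wpM2r => //.
by rewrite lerB// ltW.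
Qed.

(** The set [B] follows [A n.+1] on the time block from [K n] to [K n.+1].  The
times [K n] grow so fast that the earlier blocks are a negligible proportion of
[1, ..., K n.+1], so that the density of [B] at that time is almost that of
[A n.+1]. *)
Lemma density1_diagonal :
  (forall m, upper_density R (A m) = 1%E) <->
  exists2 B : set nat, upper_density R B = 1%E &
    forall m, exists N, forall i, (N <= i)%N -> B i -> A m i.
Proof.
split=> [H|[B /upper_density1P B1 BA] m]; last first.
  have [N HN] := BA m.
  apply/upper_density1P => e e0 K.
  have e2 : 0 < e / 2 by lra.
  have [M HM] := small_inv (divr_gt0 e2 (ltr0Sn R N)).
  have [k Kk Hk] := B1 (e / 2) e2 (maxn K M.+1).
  exists k; first by lia.
  (* The bound on [k] makes the [N] discarded visits less than [e / 2 * k]. *)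
  have V : (visits B k <= N + visits (A m) k)%N.
    by apply: visits_sub_after => i /andP[/ltnW Ni _]; exact: HN.
  have {V} V : (visits B k)%:R <= N%:R + (visits (A m) k)%:R :> R.
    by rewrite -natrD ler_nat.
  suff : N%:R < e / 2 * k%:R by lra.
  have k0 : (0 < k)%N by lia.
  have /HM : (M <= k.-1)%N by lia.
  rewrite prednK// ltr_pdivlMr ?ltr0n// mulrC ltr_pdivrMr ?ltr0n//.
  by apply: le_lt_trans; rewrite ler_nat.
have /choice[f Hf] : forall p : nat * nat, exists k, (p.2 <= k)%N /\
    (1 - p.1.+1%:R^-1 : R) * k%:R < (visits (A p.1) k)%:R.
  move=> [n N]; have /upper_density1P/(_ n.+1%:R^-1) := H n.
  rewrite invr_gt0 ltr0n => /(_ isT N)[k ? ?]; by exists k.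
(* The factor [n.+1] makes [K n] smaller than a fraction [1 / n.+2] of
[K n.+1], which is the tolerance at that stage. *)
pose K := fix K n := if n is n'.+1 then f (n, (n.+1 * K n').+1) else f (0, 1)%N.
have Kn n : (1 - n.+1%:R^-1 : R) * (K n)%:R < (visits (A n) (K n))%:R.
  by case: n => [|n]; [have [] := Hf (0, 1)%N
                     | have [] := Hf (n.+1, (n.+2 * K n).+1)].
have KS n : (n.+2 * K n < K n.+1)%N by have [] := Hf (n.+1, (n.+2 * K n).+1).
have Klt n : (K n < K n.+1)%N by apply: leq_ltn_trans (KS n); rewrite leq_pmull.
have Kmono m n : (m <= n)%N -> (K m <= K n)%N.
  by apply: (homo_leq leqnn leq_trans) => // i; exact: ltnW.
have Kge n : (n <= K n)%N.
  by elim: n => // n IH; apply: leq_ltn_trans (Klt n).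
pose B := [set i | exists2 n, A n.+1 i & (K n < i <= K n.+1)%N].
exists B.
  apply/upper_density1P => e e0 N.
  have e2 : 0 < e / 2 by lra.
  have [M HM] := small_inv e2.
  pose n := maxn N M; exists (K n.+1).
    by apply: leq_trans (Kge _); rewrite /n; lia.
  have V : (visits (A n.+1) (K n.+1) <= K n + visits B (K n.+1))%N.
    by apply: visits_sub_after => i iK Ai; exists n.
  have {}V : (visits (A n.+1) (K n.+1))%:R <=
      (K n)%:R + (visits B (K n.+1))%:R :> R by rewrite -natrD ler_nat.
  have n1 : n.+2%:R^-1 < e / 2 by apply: HM; rewrite /n; lia.
  have K0 : 0 < (K n.+1)%:R :> R by rewrite ltr0n (leq_trans _ (Kge _)).
  have KnS : (K n)%:R < n.+2%:R^-1 * (K n.+1)%:R :> R.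
    by rewrite mulrC ltr_pdivlMr ?ltr0n// -natrM ltr_nat mulnC.
  have : n.+2%:R^-1 * (K n.+1)%:R < e / 2 * (K n.+1)%:R by rewrite ltr_pM2r.
  move: (Kn n.+1) KnS V; move: (n.+2%:R^-1) (K n.+1)%:R => q k'.
  move: (visits (A _) _)%:R (visits B _)%:R (K n)%:R => v w k. nra.
move=> m; exists (K m).+1 => i mi [n Ai /andP[ni iK]].
apply: Adec Ai.
have: (m < n.+1)%N; last by lia.
rewrite ltnNge; apply/negP => /Kmono; lia.
Qed.
End Decreasing.

(** * Embeddings of the Cantor space *)

Definition agree (n : nat) (a b : nat -> bool) : Prop :=
  forall i, (i < n)%N -> a i = b i.

(** Topological embeddings of the Cantor space, spelled out with cylinders:
the first half is continuity at [a], the second half says that the inverse is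
continuous at [f a]. *)
Definition cantor_embedding (X : topologicalType) (f : (nat -> bool) -> X) :
    Prop :=
  forall a,
    (forall A, nbhs (f a) A -> exists n, forall b, agree n a b -> A (f b)) /\
    (forall n, exists2 A, nbhs (f a) A & forall b, A (f b) -> agree n a b).

Lemma cantor_embedding_inj (X : topologicalType) (f : (nat -> bool) -> X) :
  cantor_embedding f -> injective f.
Proof.
move=> fE a b fab; apply/funext => i.
have [_ /(_ i.+1)[A fA AP]] := fE a.
by apply: AP (leqnn _); rewrite -fab; exact: nbhs_singleton.
Qed.

Definition decode (X : Type) (f : (nat -> bool) -> X) (x : X) : nat -> bool :=
  xget (fun=> false) [set a | f a = x].

Lemma decodeK (X : topologicalType) (f : (nat -> bool) -> X) :
  cantor_embedding f -> cancel f (decode f).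
Proof.
move=> fE a; apply: (cantor_embedding_inj fE).
rewrite /decode; case: xgetP => [b _ //|/(_ a) na]; by case: na.
Qed.

Lemma cantor_embedding_transfer (X Y : topologicalType)
    (f : (nat -> bool) -> X) (g : (nat -> bool) -> Y) :
  cantor_embedding f -> cantor_embedding g ->
  {within range f, continuous (g \o decode f)}.
Proof.
move=> fE gE; apply/subspace_continuousP => _ [a _ <-] A /= gA'.
have gA : nbhs (g a) A by rewrite -(decodeK fE a).
have [/(_ A gA)[n nA] _] := gE a.
have [_ /(_ n)[B fB BP]] := fE a.
rewrite /fmap/= /within/=; apply: filterS fB => x Bx [b _ bx].
change (A (g (decode f x))).
by rewrite -bx (decodeK fE); apply: nA; apply: BP; rewrite bx.
Qed.

Lemma cantor_embeddings_homeomorphic (X Y : topologicalType)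
    (f : (nat -> bool) -> X) (g : (nat -> bool) -> Y) :
  cantor_embedding f -> cantor_embedding g ->
  homeomorphic_sets (range f) (range g).
Proof.
move=> fE gE; exists (g \o decode f), (f \o decode g); split; split.
- exact: cantor_embedding_transfer.
- exact: cantor_embedding_transfer.
- by move=> _ [a _ <-] /=; exists (decode f (f a)).
- by move=> _ [a _ <-] /=; exists (decode g (g a)).
- by move=> x /set_mem[a _ <-] /=; rewrite (decodeK fE) (decodeK gE).
- by move=> x /set_mem[a _ <-] /=; rewrite (decodeK gE) (decodeK fE).
Qed.

(** * The ternary Cantor set *)

Section Ternary.
Variable R : realType.

Definition ternary_term (a : nat -> bool) (n : nat) : R :=
  (a n).*2%:R / 3 ^+ n.+1.

Definition ternary (a : nat -> bool) : R := limn (series (ternary_term a)).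

(** The upper bound [2 / 3 ^ n.+1] is written as a difference so that it
telescopes in sums. *)
Lemma ternary_term_bounds a n :
  0 <= ternary_term a n <= 3^-1 ^+ n - 3^-1 ^+ n.+1.
Proof.
have h : 0 < 3^-1 ^+ n :> R by rewrite exprn_gt0 ?invr_gt0.
rewrite /ternary_term -exprVn exprS.
have -> : (a n).*2 = (if a n then 2 else 0)%N by case: (a n).
by case: (a n); apply/andP; split; lra.
Qed.

Lemma ternary_series_bounds a m n : (m <= n)%N ->
  0 <= series (ternary_term a) n - series (ternary_term a) m
    <= 3^-1 ^+ m - 3^-1 ^+ n.
Proof.
move=> /subnKC <-; elim: (n - m)%N => [|k IH].
  by rewrite addn0 !subrr lexx.
rewrite addnS seriesEnat/= in IH *; rewrite big_nat_recr//=.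
have := ternary_term_bounds a (m + k); lra.
Qed.

Lemma ternary_cvg a : series (ternary_term a) @ \oo --> ternary a.
Proof.
apply: nondecreasing_is_cvgn.
  by move=> m n mn; have := ternary_series_bounds a mn; lra.
exists 1 => _ [n _ <-]; have := ternary_series_bounds a (leq0n n).
have -> : series (ternary_term a) 0 = 0 by rewrite seriesEnat/= big_geq.
rewrite expr0.
have : 0 < 3^-1 ^+ n :> R by rewrite exprn_gt0 ?invr_gt0.
lra.
Qed.

Lemma ternary_bounds a m :
  0 <= ternary a - series (ternary_term a) m <= 3^-1 ^+ m.
Proof.
have C := cvgP _ (@ternary_cvg a); rewrite subr_ge0 lerBlDr; apply/andP; split.
  apply: (limr_ge C); exists m => // n /= mn.
  by have := ternary_series_bounds a mn; lra.
rewrite addrC; apply: (limr_le C); exists m => // n /= mn.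
have : 0 < 3^-1 ^+ n :> R by rewrite exprn_gt0 ?invr_gt0.
by have := ternary_series_bounds a mn; lra.
Qed.

Lemma ternary_series_agree a b n : agree n a b ->
  series (ternary_term a) n = series (ternary_term b) n.
Proof.
move=> ab; rewrite !seriesEnat/=; apply: eq_big_nat => i /andP[_ iltn].
by rewrite /ternary_term ab.
Qed.

Lemma ternary_dist_agree a b n : agree n a b ->
  `|ternary a - ternary b| <= 3^-1 ^+ n.
Proof.
move=> /ternary_series_agree E.
have := ternary_bounds a n; have := ternary_bounds b n; rewrite E ler_norml.
by move=> /andP[? ?] /andP[? ?]; apply/andP; split; lra.
Qed.

(** At the first difference, the term [2 / 3 ^ n.+1] of [a] exceeds by
[1 / 3 ^ n.+1] all that the remaining terms of [b] can contribute. *)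
Lemma ternary_dist_ge a b n : agree n a b -> a n -> ~~ b n ->
  3^-1 ^+ n.+1 <= `|ternary a - ternary b|.
Proof.
move=> /ternary_series_agree E an bn; apply: le_trans (ler_norm _).
have := ternary_bounds a n.+1; have := ternary_bounds b n.+1.
rewrite !seriesEnat/= in E *; rewrite !big_nat_recr//= E.
rewrite /ternary_term an (negbTE bn) double0 (_ : true.*2 = 2)%N//.
rewrite mul0r -exprVn exprS; lra.
Qed.

Lemma ternary_agree a b n :
  `|ternary a - ternary b| < 3^-1 ^+ n -> agree n a b.
Proof.
elim: n => // n IH H.
have h : 0 < 3^-1 ^+ n :> R by rewrite exprn_gt0 ?invr_gt0.
have ab : agree n a b.
  by apply: IH; apply: lt_le_trans H _; rewrite exprS; lra.
move=> i; rewrite ltnS leq_eqVlt => /predU1P[->|]; last exact: ab.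
case an : (a n); case bn : (b n) => //.
  by move: H; rewrite ltNge (ternary_dist_ge ab)// bn.
move: H; rewrite distrC ltNge (@ternary_dist_ge _ _ n) ?an//.
by move=> j jn; rewrite ab.
Qed.

Lemma ternary_embedding : cantor_embedding ternary.
Proof.
move=> a; split.
  move=> A /nbhs_ballP[e /= e0 eA].
  have [N _ HN] := near_infty_natSinv_expn_lt (PosNum e0).
  exists N => b ab; apply: eA; rewrite /ball/=.
  apply: le_lt_trans (ternary_dist_agree ab) _.
  apply: le_lt_trans (HN N (leqnn _)); rewrite div1r -exprVn.
  by apply: lerXn2r; rewrite ?nnegrE ?invr_ge0// lef_pV2 ?posrE//; lra.
move=> n; exists (ball (ternary a) (3^-1 ^+ n)).
  by apply: nbhsx_ballx; rewrite exprn_gt0 ?invr_gt0.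
by move=> b; rewrite /ball/=; exact: ternary_agree.
Qed.

Lemma range_ternary : range ternary = @ternary_cantor_set R.
Proof.
apply/seteqP; split=> [_ [a _ <-]|x [a ax]]; exists a => //.
  exact: ternary_cvg.
exact: (cvg_lim _ ax).
Qed.

Lemma cantor_embedding_range (X : topologicalType) (f : (nat -> bool) -> X) :
  cantor_embedding f -> is_cantor_set R (range f).
Proof.
move=> fE; rewrite /is_cantor_set -range_ternary.
exact: cantor_embeddings_homeomorphic ternary_embedding.
Qed.

(** A scrambled set says nothing about a pair of equal points; this provides
the distinct one. *)
Lemma cantor_set_other (X : topologicalType) (K : set X) (x : X) :
  is_cantor_set R K -> exists y, K y /\ y <> x.
Proof.
move=> [f [g [[_ _ _ gK] [_ fg]]]].
have C a : @ternary_cantor_set R (ternary a).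
  by rewrite -range_ternary; exists a.
have [gx|] := pselect (g (ternary (fun=> false)) = x); last first.
  by exists (g (ternary (fun=> false))); split=> //; apply: gK.
exists (g (ternary (fun=> true))); split; first exact: gK.
rewrite -gx => /(congr1 f); rewrite !fg ?inE//.
by move=> /(cantor_embedding_inj ternary_embedding)/(congr1 (@^~ 0%N)).
Qed.

End Ternary.

(** * Separating the points of a topological group by quotients *)

Section MetricTopology.
Variables (R : realType) (X : topologicalType) (d : X -> X -> R).
Hypotheses (dpm : is_pseudometric d) (dtop : induces_topology d).

Lemma metric_ball_open x r : open [set y | d x y < r].
Proof.
have [_ _ _ tri] := dpm.
rewrite openE => y /= xy; apply/dtop; exists (r - d x y).
  by rewrite subr_gt0.
move=> z /= yz; have := tri x y z; lra.
Qed.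

Lemma open_contains_ball (O : set X) e : open O -> O !=set0 -> 0 < e ->
  exists p : X * R, [/\ 0 < p.2, p.2 < e & [set y | d p.1 y <= p.2] `<=` O].
Proof.
rewrite openE => oO [x Ox] e0.
have /dtop[r r0 rO] := oO _ Ox.
pose q := Num.min r e / 2.
have m0 : 0 < Num.min r e by rewrite lt_min r0.
exists (x, q); split=> /=; rewrite /q.
- lra.
- have : Num.min r e <= e by rewrite ge_min lexx orbT.
  lra.
- move=> y /= xy; apply: rO => /=.
  have : Num.min r e <= r by rewrite ge_min lexx.
  lra.
Qed.
End MetricTopology.

Lemma division_continuous (G : topologicalGroupType) :
  continuous (fun p : G * G => (p.1^-1 * p.2)%g).
Proof.
move=> p; apply: (@continuous_comp _ _ _ (fun p : G * G => (p.1^-1%g, p.2))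
  (fun p : G * G => (p.1 * p.2)%g)); last exact: mulg_continuous.
apply: cvg_pair; last exact: cvg_snd.
apply: (@continuous_comp _ _ _ fst (fun x : G => x^-1%g)).
  exact: cvg_fst.
exact: invg_continuous.
Qed.

(** For a point [c] of [C], the open set [c^-1 * D] meets the dense set [U], so
[(c, c * z)] is, for some [z], a pair of [C * D] with quotient in [U]; a
product neighbourhood of that pair will do. *)
Lemma separate_pair (G : topologicalGroupType) (U C D : set G) :
  open U -> dense U -> open C -> C !=set0 -> open D -> D !=set0 ->
  exists C' D' : set G, [/\ open C' /\ C' !=set0, open D' /\ D' !=set0,
    C' `<=` C, D' `<=` D &
    forall x y, C' x -> D' y -> U (x^-1 * y)%g].
Proof.
move=> oU dU oC [c Cc] oD [e De].
have cont := @division_continuous G.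
have contc : continuous (fun z : G => (c * z)%g).
  move=> z; apply: (@continuous_comp _ _ _ (fun z : G => (c, z))
    (fun p : G * G => (p.1 * p.2)%g)); last exact: mulg_continuous.
  by apply: cvg_pair; [exact: cvg_cst|exact: cvg_id].
have oV : open [set z | D (c * z)%g].
  by apply: open_comp oD => z _; exact: contc.
have V0 : [set z | D (c * z)%g] !=set0.
  by exists (c^-1 * e)%g; rewrite /= mulVKg.
have [z [/= Dz Uz]] := dU _ V0 oV.
have : nbhs (c, (c * z)%g) [set p : G * G | U (p.1^-1 * p.2)%g].
  by apply: (cont (c, (c * z)%g)); rewrite /= mulKg; exact: open_nbhs_nbhs.
case=> -[A B] /= [Ac Bz] AB.
exists (interior A `&` C), (interior B `&` D); split.
- split; first by apply: openI => //; exact: open_interior.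
  by exists c; split.
- split; first by apply: openI => //; exact: open_interior.
  by exists (c * z)%g; split.
- by move=> ? [].
- by move=> ? [].
- move=> x y [/interior_subset Ax _] [/interior_subset By _].
  by apply: (AB (x, y)).
Qed.

(** The pairs are treated one at a time: shrinking the sets further keeps the
quotients that are already in [U]. *)
Lemma separate_pairs (G : topologicalGroupType) (I : eqType) (U : set G)
    (C : I -> set G) (s : seq (I * I)) :
  open U -> dense U -> (forall i, open (C i) /\ C i !=set0) ->
  exists B : I -> set G, [/\ forall i, open (B i) /\ B i !=set0,
    forall i, B i `<=` C i &
    forall i j, (i, j) \in s -> i != j ->
      forall x y, B i x -> B j y -> U (x^-1 * y)%g].
Proof.
move=> oU dU oC; elim: s => [|[i j] s [B [oB BC BU]]].
  by exists C; split=> // i; exact: subset_refl.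
have [<- | ij] := eqVneq i j.
  exists B; split=> // k l; rewrite inE => /orP[/eqP[-> ->]|]; last exact: BU.
  by rewrite eqxx.
have [opi nei] := oB i; have [opj nej] := oB j.
have [B1 [B2 [oB1 oB2 s1 s2 HU]]] := separate_pair oU dU opi nei opj nej.
pose B' k := if k == i then B1 else if k == j then B2 else B k.
have sB' k : B' k `<=` B k.
  by rewrite /B'; case: eqVneq => [->//|_]; case: eqVneq => [->//|_].
exists B'; split.
- by move=> k; rewrite /B'; case: eqVneq => // _; case: eqVneq.
- by move=> k; exact: subset_trans (BC k).
- move=> k l; rewrite inE => /orP[/eqP[-> ->] _ x y|kl kNl x y Bx By].
    by rewrite /B' eqxx (negbTE (_ : j != i)) ?eqxx 1?eq_sym//; exact: HU.
  by apply: (BU k l kl kNl); exact: sB'.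
Qed.

(** * Cantor schemes *)

(** The last bit comes first, so that [behead] maps a node of the binary tree to
its parent. *)
Fixpoint prefix (a : nat -> bool) (n : nat) : seq bool :=
  if n is m.+1 then a m :: prefix a m else [::].

Lemma prefix_agree a b n : prefix a n = prefix b n <-> agree n a b.
Proof.
elim: n => [|n IH]; first by split.
split=> [/= [an /IH ab] i|ab] /=.
  by rewrite ltnS leq_eqVlt => /predU1P[->//|]; exact: ab.
by rewrite ab//; congr cons; apply/IH => i /ltnW; exact: ab.
Qed.

Lemma size_prefix a n : size (prefix a n) = n.
Proof. by elim: n => //= n ->. Qed.

(** The nodes that must be separated at stage [n]: those of depth [n] in the
first [n] of the countably many trees.  They are finite in number, and any two
branches have distinct nodes among them at all late stages. *)
Definition nodes (n : nat) : seq (nat * seq bool) :=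
  [seq (j, tval t) | j <- iota 0 n, t <- enum {: n.-tuple bool}].

Lemma mem_nodes n j a : (j < n)%N -> (j, prefix a n) \in nodes n.
Proof.
move=> jn; apply/allpairsP.
exists (j, Tuple (introT eqP (size_prefix a n))) => /=.
by rewrite mem_iota mem_enum.
Qed.

Section Scheme.
Variables (R : realType) (G : topologicalGroupType) (D : G -> G -> R).
Hypotheses (Dmet : complete_metric D) (Dtop : induces_topology D).
Variables (U : nat -> set G) (O : nat -> set G).
Hypotheses (Uopen : forall n, open (U n)) (Udense : forall n, dense (U n)).
Hypothesis Udec : forall m n, (m <= n)%N -> U n `<=` U m.
Hypothesis U1 : ~ U 0 1%g.
Hypothesis Ok : forall j, open (O j) /\ O j !=set0.

Let Dpm : is_pseudometric D. Proof. by case: Dmet => -[]. Qed.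

Let pball (p : G * R) : set G := [set y | D p.1 y < p.2].
Let pcball (p : G * R) : set G := [set y | D p.1 y <= p.2].

Let pcenter (p : G * R) : 0 < p.2 -> pball p p.1.
Proof. by have [_ D0 _ _] := Dpm; rewrite /pball/= D0. Qed.

Lemma scheme_step (n : nat) (F : nat * seq bool -> G * R) :
  (forall i, 0 < (F i).2) ->
  exists F' : nat * seq bool -> G * R,
  [/\ forall i, 0 < (F' i).2, forall i, (F' i).2 < n.+1%:R^-1,
    forall j s, pcball (F' (j, s)) `<=` pball (F (j, behead s)) &
    forall i j, i \in nodes n.+1 -> j \in nodes n.+1 -> i != j ->
      forall x y, pball (F' i) x -> pball (F' j) y -> U n (x^-1 * y)%g].
Proof.
move=> F0.
have oC (i : nat * seq bool) :
    open (pball (F (i.1, behead i.2))) /\ pball (F (i.1, behead i.2)) !=set0.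
  split; first exact: metric_ball_open.
  by exists (F (i.1, behead i.2)).1; exact: pcenter.
have [B [oB BC BU]] := separate_pairs
  [seq (i, j) | i <- nodes n.+1, j <- nodes n.+1] (Uopen n) (@Udense n) oC.
have n0 : 0 < n.+1%:R^-1 :> R by rewrite invr_gt0.
have /choice[F' HF'] : forall i, exists p : G * R,
    [/\ 0 < p.2, p.2 < n.+1%:R^-1 & pcball p `<=` B i].
  move=> i; have [oB1 oB2] := oB i.
  exact: (open_contains_ball Dtop oB1 oB2 n0).
exists F'; split.
- by move=> i; have [] := HF' i.
- by move=> i; have [] := HF' i.
- by move=> j s; have [_ _ sB] := HF' (j, s); exact: subset_trans (BC (j, s)).
- move=> i j ni nj ij x y Bx By; have [_ _ si] := HF' i; have [_ _ sj] := HF' j.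
  apply: (BU i j) => //; [|exact: si (ltW Bx)|exact: sj (ltW By)].
  by apply/allpairsP; exists (i, j).
Qed.

Lemma scheme_exists : exists F : nat -> nat * seq bool -> G * R,
  [/\ forall n i, (F n.+1 i).2 < n.+1%:R^-1,
    forall j s, pball (F 0 (j, s)) `<=` O j,
    forall n j s, pcball (F n.+1 (j, s)) `<=` pball (F n (j, behead s)),
    forall n i, 0 < (F n i).2 &
    forall n i j, i \in nodes n.+1 -> j \in nodes n.+1 -> i != j ->
      forall x y, pball (F n.+1 i) x -> pball (F n.+1 j) y ->
      U n (x^-1 * y)%g].
Proof.
have /choice[E0 HE0] : forall j, exists p : G * R,
    [/\ 0 < p.2, p.2 < 1 & pcball p `<=` O j].
  move=> j; have [oB1 oB2] := Ok j.
  exact: (open_contains_ball Dtop oB1 oB2 ltr01).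
have /choice[next Hnext] : forall p : nat * (nat * seq bool -> G * R),
  exists F' : nat * seq bool -> G * R, (forall i, 0 < (p.2 i).2) ->
  [/\ forall i, 0 < (F' i).2, forall i, (F' i).2 < p.1.+1%:R^-1,
    forall j s, pcball (F' (j, s)) `<=` pball (p.2 (j, behead s)) &
    forall i j, i \in nodes p.1.+1 -> j \in nodes p.1.+1 -> i != j ->
      forall x y, pball (F' i) x -> pball (F' j) y -> U p.1 (x^-1 * y)%g].
  move=> [n F]; have [F0|nF0] := pselect (forall i, 0 < (F i).2).
    by have [F' HF'] := scheme_step n F0; exists F'.
  by exists F.
pose F := fix F n := if n is m.+1 then next (m, F m) else fun i => E0 i.1.
have Fpos n : forall i, 0 < (F n i).2.
  elim: n => [i|n IH]; first by have [] := HE0 i.1.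
  by have [] := Hnext (n, F n) IH.
have step n := Hnext (n, F n) (Fpos n).
exists F; split=> //.
- by move=> n; have [] := step n.
- by move=> j s x xB; have [_ _] := HE0 j; apply; exact: ltW.
- by move=> n; have [] := step n.
- by move=> n; have [] := step n.
Qed.

(** The limits of the balls along the branches.  If the balls at two distinct
separated nodes had a common point, the quotient of that point by itself would
put the identity in some [U n]; so a small ball around [f j a] meets only the
branches that share a prefix with [a]. *)
Lemma scheme_branches : exists f : nat -> (nat -> bool) -> G,
  [/\ forall j a, O j (f j a), forall j, cantor_embedding (f j) &
    forall i j a b, f i a <> f j b -> forall n, U n ((f i a)^-1 * f j b)%g].
Proof.
have [F [Frad FO Fnest Fpos FU]] := scheme_exists.
have [Dge D0 Dsym Dtri] := Dpm.
have nest j a m n : (m <= n)%N ->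
    pball (F n (j, prefix a n)) `<=` pball (F m (j, prefix a m)).
  move=> /subnKC <-; elim: (n - m)%N => [|k IH]; first by rewrite addn0.
  rewrite addnS => x xB; apply: IH.
  by apply: Fnest (ltW xB).
have /choice[f Hf] : forall p : nat * (nat -> bool), exists l,
    forall m, pball (F m (p.1, prefix p.2 m)) l.
  move=> [j a] /=.
  pose u n := (F n (j, prefix a n)).1.
  have uB m n : (m <= n)%N -> D (u m) (u n) < (F m (j, prefix a m)).2.
    by move=> mn; apply: (nest _ _ _ _ mn); exact: pcenter.
  have [_ /(_ u)[|l ul]] := Dmet.
    move=> e e0; have e2 : 0 < e / 2 by lra.
    have [N HN] := small_inv e2.
    exists N.+1 => m n Nm Nn.
    have := HN _ (leqnn N); have := Frad N (j, prefix a N.+1).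
    have := uB _ _ Nm; have := uB _ _ Nn; have := Dtri (u m) (u N.+1) (u n).
    rewrite (Dsym (u m) (u N.+1)).
    move: (N.+1%:R^-1) (F _ _).2 => q r; lra.
  (* The limit is only known to be in the closed balls; the one at stage [m.+1]
  is inside the open ball at stage [m]. *)
  exists l => m; apply: (Fnest m j (prefix a m.+1)); rewrite /pcball/=.
  apply/ler_addgt0Pr => e e0.
  have /cvgrPdist_lt/(_ e e0)[N _ HN] := ul.
  have := HN (maxn N m.+1) (leq_maxl _ _); rewrite sub0r normrN ger0_norm//.
  have := uB _ _ (leq_maxr N m.+1).
  by have := Dtri (u m.+1) (u (maxn N m.+1)) l; rewrite /u/=; lra.
have sep i j a b n : (i <= n)%N -> (j <= n)%N ->
    (i, prefix a n.+1) != (j, prefix b n.+1) ->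
    forall x y, pball (F n.+1 (i, prefix a n.+1)) x ->
      pball (F n.+1 (j, prefix b n.+1)) y -> U n (x^-1 * y)%g.
  by move=> ni nj ne; apply: FU ne; exact: mem_nodes.
exists (fun j a => f (j, a)); split.
- by move=> j a; exact: FO (Hf (j, a) 0%N).
- move=> j a; split=> [A /Dtop[e e0 eA]|n].
    have e2 : 0 < e / 2 by lra.
    have [N HN] := small_inv e2.
    exists N.+1 => b /prefix_agree ab; apply: eA.
    have := HN _ (leqnn N); have := Frad N (j, prefix a N.+1).
    have Hb : pball (F N.+1 (j, prefix b N.+1)) (f (j, b)) := Hf (j, b) N.+1.
    have Ha : pball (F N.+1 (j, prefix a N.+1)) (f (j, a)) := Hf (j, a) N.+1.
    move: Ha Hb; rewrite -ab /pball.
    have := Dtri (f (j, a)) (F N.+1 (j, prefix a N.+1)).1 (f (j, b)).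
    rewrite (Dsym (f (j, a)) (F N.+1 (j, prefix a N.+1)).1).
    move: (F _ _) (N.+1%:R^-1) => [c r] q /=; lra.
  pose M := maxn n j.
  exists (pball (F M.+1 (j, prefix a M.+1))).
    apply: open_nbhs_nbhs; split; first exact: metric_ball_open.
    exact: (Hf (j, a)).
  move=> b bA; apply: contrapT => nab; apply: U1; apply: (Udec (leq0n M)).
  rewrite -(mulVg (f (j, b))).
  apply: (sep j j a b M) => //; rewrite ?leq_maxr//; last exact: (Hf (j, b)).
  apply/eqP => /(congr1 snd)/prefix_agree ab; apply: nab => i ni.
  by apply: ab; rewrite /M; lia.
- move=> i j a b ne n.
  have [k Hk] : exists k, i = j -> a k <> b k.
    have [ij|ij] := eqVneq i j; last by exists 0%N => /eqP; rewrite (negbTE ij).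
    apply: contrapT => /forallNP H; apply: ne; rewrite ij; congr (f (_, _)).
    by apply/funext => k; apply: contrapT => abk; apply: (H k) => _.
  pose M := maxn (maxn n k) (maxn i j).
  apply: (@Udec n M); first by rewrite /M; lia.
  apply: (sep i j a b M); rewrite /M ?leq_maxr//; try lia.
  + apply/eqP => e; apply: Hk (congr1 fst e) _.
    by move/(congr1 snd)/prefix_agree: e; apply; rewrite /M; lia.
  + exact: (Hf (i, a)).
  + exact: (Hf (j, b)).
Qed.

End Scheme.

(** A form of Mycielski's theorem for the relations [U n (x^-1 * y)].  The
hypothesis that [U 0] avoids the identity also excludes isolated points, which
would leave no room for a Cantor set: in a discrete group the dense set [U 0]
would be everything. *)
Lemma cantor_family (R : realType) (G : topologicalGroupType)
    (hG : completely_metrizable R G) (U : nat -> set G) (O : nat -> set G) :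
  (forall n, open (U n)) -> (forall n, dense (U n)) ->
  (forall m n, (m <= n)%N -> U n `<=` U m) -> ~ U 0 1%g ->
  (forall j, open (O j) /\ O j !=set0) ->
  exists K : nat -> set G, (forall j, is_cantor_set R (K j) /\ K j `<=` O j) /\
    forall x y, (\bigcup_j K j) x -> (\bigcup_j K j) y -> x <> y ->
    forall n, U n (x^-1 * y)%g.
Proof.
move=> Uo Ud Udec U1 Ok; have [D [Dmet Dtop]] := hG.
have [f [fO femb fU]] := scheme_branches Dmet Dtop Uo Ud Udec U1 Ok.
exists (fun j => range (f j)); split=> [j|]; last first.
  by move=> _ _ [i _ [a _ <-]] [j _ [b _ <-]] ne n; exact: fU.
by split=> [|_ [a _ <-]//]; exact: cantor_embedding_range.
Qed.

(** * Orbits of an endomorphism *)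

Section Orbits.
Variables (R : realType) (G : topologicalGroupType).
Variable T : {multiplicative G -> G}.
Hypothesis Tcont : continuous T.

Definition hits (Q : nat -> set G) (x : G) (m : nat) : set nat :=
  [set n | Q m (iter n T x)].

Definition often (Q : nat -> set G) (n : nat) : set G :=
  [set x | frequently R (hits Q x) n].

Lemma iter_continuous n : continuous (iter n T).
Proof.
elim: n => [|n IH] x; first exact: cvg_id.
by apply: (@continuous_comp _ _ _ (iter n T) T); [exact: IH|exact: Tcont].
Qed.

(** Whether [x] belongs to [often Q n] is witnessed by finitely many visits of
its orbit to an open set, and nearby orbits make the same visits. *)
Lemma often_open (Q : nat -> set G) n : (forall m, open (Q m)) ->
  open (often Q n).
Proof.
move=> Qo; rewrite openE => x [k nk kx].
have : \forall y \near x, forall i, (i <= k)%N -> hits Q x n i -> hits Q y n i.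
  elim: k {nk kx} => [|k IH].
    have [Qx|nQ] := pselect (Q n x).
      near=> y => i; rewrite leqn0 => /eqP -> _.
      near: y; exact: (open_nbhs_nbhs (conj (Qo n) Qx)).
    by near=> y => i; rewrite leqn0 => /eqP -> /nQ.
  have H : \forall y \near x, hits Q x n k.+1 -> hits Q y n k.+1.
    have [Qx|nQ] := pselect (hits Q x n k.+1); last by near=> y => /nQ.
    have C : \forall y \near x, Q n (iter k.+1 T y).
      apply: (@iter_continuous k.+1 x).
      exact: (open_nbhs_nbhs (conj (Qo n) Qx)).
    by apply: filterS C => y Qy _.
  near=> y => i; rewrite leq_eqVlt => /predU1P[->|]; first by near: y.
  by rewrite ltnS; move: i; near: y.
apply: filterS => y xy; exists k => //.
apply: lt_le_trans kx _; rewrite ler_nat.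
by apply: (@visits_sub_after _ _ 0) => i /andP[_ ik]; exact: xy.
Unshelve. all: by end_near.
Qed.

Section DecreasingTargets.
Variable Q : nat -> set G.
Hypothesis Qdec : forall m n, (m <= n)%N -> Q n `<=` Q m.

Lemma hits_dec x m n : (m <= n)%N -> hits Q x n `<=` hits Q x m.
Proof. by move=> mn i; exact: Qdec. Qed.

Lemma often_dec m n : (m <= n)%N -> often Q n `<=` often Q m.
Proof. by move=> mn x; apply: frequently_dec mn => i j ij; exact: hits_dec. Qed.

Lemma often_densityP x :
  (forall n, often Q n x) <-> (forall m, upper_density R (hits Q x m) = 1%E).
Proof.
by apply: iff_sym; apply: density1_frequentlyP => m n mn; exact: hits_dec.
Qed.

Lemma often_alongP x :
  (forall n, often Q n x) <->
  exists2 B : set nat, upper_density R B = 1%E &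
    forall m, exists N, forall i, (N <= i)%N -> B i -> Q m (iter i T x).
Proof.
apply: iff_trans (often_densityP x) _.
by apply: density1_diagonal => m n mn; exact: hits_dec.
Qed.
End DecreasingTargets.

Lemma iter_mul n x y : iter n T (x * y)%g = (iter n T x * iter n T y)%g.
Proof. by elim: n => //= n ->; rewrite gmulfM. Qed.

Lemma iter_one n : iter n T 1%g = 1%g.
Proof.
have := iter_mul n 1%g 1%g.
rewrite mulg1 => /(congr1 (fun z => z / iter n T 1)%g).
by rewrite mulgK mulgV.
Qed.

(** Translating by [(T^n x)^-1] reduces the comparison of two orbits to the
behaviour of the single orbit of [x^-1 * y] relative to the identity. *)
Lemma left_invariant_orbit (p : G -> G -> R) n x y : left_invariant p ->
  p (iter n T x) (iter n T y) = p 1%g (iter n T (x^-1 * y)%g).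
Proof.
move=> pinv; rewrite -(pinv 1%g _ (iter n T x)) mulg1 -iter_mul.
by rewrite mulVKg.
Qed.

Variables (d rho : G -> G -> R).
Hypotheses (hd : compatible_metric d) (d_inv : left_invariant d).
Hypotheses (hrho : continuous_pseudometric rho) (rho_inv : left_invariant rho).

Definition near_one (m : nat) : set G := [set z | d 1%g z < m.+1%:R^-1].
Definition far_from_one (m : nat) : set G := [set z | m%:R < rho z 1%g].

Lemma near_one_open m : open (near_one m).
Proof. by have [[dpm _] dtop] := hd; exact: metric_ball_open. Qed.

Lemma near_one_dec m n : (m <= n)%N -> near_one n `<=` near_one m.
Proof.
move=> mn z /lt_le_trans; apply.
by rewrite lef_pV2 ?posrE ?ltr0n// ler_nat.
Qed.

Lemma far_from_one_open m : open (far_from_one m).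
Proof.
have [_ rcont] := hrho.
have c : continuous (fun z : G => rho z 1%g).
  move=> z; apply: (@continuous_comp _ _ _ (fun z : G => (z, 1%g))
    (fun p : G * G => rho p.1 p.2)); last exact: rcont.
  by apply: cvg_pair; [exact: cvg_id|exact: cvg_cst].
apply: (@open_comp _ _ (fun z : G => rho z 1%g) [set r : R | m%:R < r]).
  by move=> z _; exact: c.
exact: open_gt.
Qed.

Lemma far_from_one_dec m n : (m <= n)%N -> far_from_one n `<=` far_from_one m.
Proof. by move=> mn z; apply: le_lt_trans; rewrite ler_nat. Qed.

Lemma unboundedP x : distributionally_unbounded rho T x <->
  forall n, often far_from_one n x.
Proof.
apply: iff_trans (iff_sym (often_alongP far_from_one_dec x)).
split=> [[B [B1 /cvgryPgt BP]]|[B B1 BP]].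
  exists B => // m; have [N _ HN] := BP m%:R.
  by exists N => i Ni Bi; exact: (HN i Ni Bi).
exists B; split=> //; apply/cvgryPgt => M.
have [N HN] := BP (Num.bound `|M|).
exists N => // i /= Ni Bi.
apply: le_lt_trans (HN i Ni Bi).
exact: le_trans (ler_norm M) (ltW (archi_boundP (normr_ge0 M))).
Qed.

Lemma cvg_one_oftenP x :
  (exists A : set nat, upper_density R A = 1%E /\
    iter n T x @[n --> within A \oo] --> (1%g : G)) <->
  forall n, often near_one n x.
Proof.
have [_ dtop] := hd.
apply: iff_trans (iff_sym (often_alongP near_one_dec x)).
split=> [[A [A1 AP]]|[A A1 AP]].
  exists A => // m.
  have [|N _ HN] := AP (near_one m).
    by apply/dtop; exists m.+1%:R^-1 => //; rewrite invr_gt0 ltr0n.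
  by exists N => i Ni Ai; exact: (HN i Ni Ai).
exists A; split=> // B /dtop[e e0 eB].
have [m Hm] := small_inv e0; have [N HN] := AP m.
exists N => // i /= Ni Ai; apply: eB => /=.
exact: lt_trans (HN i Ni Ai) (Hm _ (leqnn _)).
Qed.

Lemma proximalP x y : distributionally_proximal d T x y <->
  forall n, often near_one n (x^-1 * y)%g.
Proof.
apply: iff_trans (iff_sym (often_densityP near_one_dec _)).
split=> [H m|H e e0].
  apply: upper_density1_sub (H m.+1%:R^-1 _); last by rewrite invr_gt0 ltr0n.
  by move=> n /=; rewrite (left_invariant_orbit _ _ _ d_inv).
have [m Hm] := small_inv e0.
apply: upper_density1_sub (H m) => n /=.
rewrite (left_invariant_orbit _ _ _ d_inv) => /lt_trans; apply; exact: Hm.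
Qed.

Definition chaotic_level (n : nat) : set G :=
  often near_one n `&` often far_from_one n.

Lemma extremely_chaoticP x y :
  distributionally_extremely_chaotic1 d rho T x y <->
  forall n, chaotic_level n (x^-1 * y)%g.
Proof.
have [[_ _ rsym _] _] := hrho.
have E n : rho (iter n T x) (iter n T y) = rho (iter n T (x^-1 * y)%g) 1%g.
  by rewrite (left_invariant_orbit _ _ _ rho_inv) rsym.
split=> [[/proximalP Hp Hr] n|H].
  split; first exact: Hp.
  move: n; apply/(often_densityP far_from_one_dec) => m.
  apply: upper_density1_sub (Hr m.+1%:R _); last by rewrite ltr0n.
  by move=> n /=; rewrite E; apply: lt_trans; rewrite ltr_nat.
split; first by apply/proximalP => n; have [] := H n.
move=> M M0.
have /(often_densityP far_from_one_dec) Hf :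
    forall n, often far_from_one n (x^-1 * y)%g.
  by move=> n; have [] := H n.
apply: upper_density1_sub (Hf (Num.bound M)) => n /=; rewrite E.
by apply: lt_trans; exact: archi_boundP (ltW M0).
Qed.

Lemma irregularP x : distributionally_irregular1 rho T x <->
  forall n, chaotic_level n x.
Proof.
split=> [[/unboundedP Hu /cvg_one_oftenP Ho] n|H]; first by split.
by split; [apply/unboundedP|apply/cvg_one_oftenP] => n; have [] := H n.
Qed.

(** The orbit of the identity is constant; this is what keeps the sets of the
Cantor schemes disjoint. *)
Lemma one_not_far n : ~ often far_from_one n 1%g.
Proof.
move=> [k _]; have [[_ r0 _ _] _] := hrho.
have -> : hits far_from_one 1%g n = set0.
  apply/seteqP; split=> // i; rewrite /hits/far_from_one/= iter_one r0.
  by rewrite ltrn0.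
have -> : visits set0 k = 0%N.
  rewrite /visits (eq_count (a2 := pred0)) ?count_pred0// => i.
  by apply/negbTE/negP => /set_mem.
apply/negP; rewrite -leNgt mulr_ge0// subr_ge0 invf_le1 ?ltr0n//.
by rewrite ler1n.
Qed.

Lemma chaotic_level_open n : open (chaotic_level n).
Proof.
by apply: openI; apply: often_open => m;
  [exact: near_one_open|exact: far_from_one_open].
Qed.

Lemma chaotic_level_dec m n : (m <= n)%N ->
  chaotic_level n `<=` chaotic_level m.
Proof.
move=> mn x [xn xf]; split.
  by apply: (often_dec near_one_dec mn).
by apply: (often_dec far_from_one_dec mn).
Qed.

Lemma dense_sub (A B : set G) : A `<=` B -> dense A -> dense B.
Proof.
by move=> sAB dA O O0 oO; have [x [Ox /sAB Bx]] := dA O O0 oO; exists x.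
Qed.

Lemma scrambled_cantor_family (hG : completely_metrizable R G) :
  (forall n, dense (chaotic_level n)) ->
  forall O : nat -> set G, (forall j, open (O j) /\ O j !=set0) ->
    exists K : nat -> set G,
      (forall j, is_cantor_set R (K j) /\ K j `<=` O j) /\
      distributionally_extremely_scrambled1 d rho T (\bigcup_j K j).
Proof.
move=> Ud O Ok.
have U1 : ~ chaotic_level 0 1%g by move=> [_ /one_not_far].
have [K [KO KU]] :=
  cantor_family hG chaotic_level_open Ud chaotic_level_dec U1 Ok.
exists K; split=> // x y Kx Ky xy.
by apply/extremely_chaoticP; exact: KU.
Qed.

(** Near [(1, w)] all quotients [x^-1 * y] stay in [W]; a scrambled family
with one Cantor set near [1] and another near [w] therefore puts one of its
irregular quotients in [W]. *)
Lemma scrambled_dense_quotients :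
  (forall O : nat -> set G, (forall j, open (O j) /\ O j !=set0) ->
    exists K : nat -> set G,
      (forall j, is_cantor_set R (K j) /\ K j `<=` O j) /\
      distributionally_extremely_scrambled1 d rho T (\bigcup_j K j)) ->
  dense [set z | forall n, chaotic_level n z].
Proof.
move=> H W [w Ww] oW.
have : nbhs (1%g, w) [set p : G * G | W (p.1^-1 * p.2)%g].
  apply: (@division_continuous G (1%g, w)).
  by rewrite /= invg1 mul1g; exact: open_nbhs_nbhs.
case=> -[A B] /= [A1 Bw] AB.
pose O j := if j is 0%N then interior A else interior B.
have [j|K [KO Kscr]] := H O.
  by case: j => [|j]; split;
    [exact: open_interior|exists 1%g|exact: open_interior|exists w].
have [K0 K0A] := KO 0%N; have [K1 K1B] := KO 1%N.
have [x [K0x _]] := @cantor_set_other R G _ 1%g K0.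
have [y [K1y yx]] := @cantor_set_other R G _ x K1.
exists (x^-1 * y)%g; split.
  by apply: (AB (x, y)); split; apply: interior_subset; [exact: K0A|exact: K1B].
by apply/extremely_chaoticP; apply: Kscr;
  [exists 0%N|exists 1%N|exact/nesym].
Qed.

End Orbits.

(** * The equivalence *)

Theorem theorem5p28 (R : realType) (G : topologicalGroupType)
  (hG : completely_metrizable R G)
  (d : G -> G -> R) (hd : compatible_metric d) (d_inv : left_invariant d)
  (rho : G -> G -> R) (hrho : continuous_pseudometric rho)
  (rho_inv : left_invariant rho)
  (T : {multiplicative G -> G}) (hT : continuous T) :
  [<-> exists2 D : set G, dense D
         & D `<=` [set x | distributionally_irregular1 rho T x];
       exists2 D : set G, residual D
         & D `<=` [set x | distributionally_irregular1 rho T x];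
       forall O : nat -> set G, (forall j, open (O j) /\ O j !=set0) ->
         exists K : nat -> set G,
           (forall j, is_cantor_set R (K j) /\ K j `<=` O j) /\
           distributionally_extremely_scrambled1 d rho T (\bigcup_j K j);
       dense (distributionally_proximal_cell d T 1%g) /\
         exists2 D : set G, dense D
           & D `<=` [set x | distributionally_unbounded rho T x]].
Proof.
have irrP := irregularP T rho hd.
have Uopen := chaotic_level_open hT hd hrho.
tfae.
- move=> [D dD Dirr].
  pose E := \bigcap_n chaotic_level T d rho n.
  have DE : D `<=` E by move=> x /Dirr/irrP xE n _; exact: xE.
  exists E; last by move=> x xE; apply/irrP => n; exact: xE.
  exists E; split; [|exact: dense_sub DE dD|by []].
  by exists (chaotic_level T d rho) => // n; exact: Uopen.
- move=> [D [E [_ dE ED]] Dirr]; apply: scrambled_cantor_family => // n.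
  by apply: dense_sub dE => x /ED/Dirr/irrP xE; exact: xE.
- move=> /(scrambled_dense_quotients d_inv hrho rho_inv) dQ; split.
    apply: dense_sub dQ => x Qx; apply/(proximalP T d_inv) => n.
    by rewrite invg1 mul1g; have [] := Qx n.
  exists [set z | forall n, chaotic_level T d rho n z] => // x Qx.
  by apply/unboundedP => n; have [] := Qx n.
(* Only the density of each level is at hand here; the Cantor families restore
the density of their intersection. *)
- move=> [dP [D dD Dunb]].
  have dU n : dense (chaotic_level T d rho n).
    apply: denseI.
    + by apply: often_open => // m; exact: near_one_open.
    + apply: dense_sub dP => x /(proximalP T d_inv)/(_ n).
      by rewrite invg1 mul1g.
    + by apply: dense_sub dD => x /Dunb/unboundedP xE; exact: xE.
  have /(scrambled_dense_quotients d_inv hrho rho_inv) dQ :=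
    scrambled_cantor_family hT hd d_inv hrho rho_inv hG dU.
  exists [set z | forall n, chaotic_level T d rho n z] => // x Qx.
  exact/irrP.
Qed.
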